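(* Let $m$ be a natural number. Then $\mathcal{C}_m$ is a regular subset of $\Sigma_m^*$.
   Context: An $m\times n$ diagram is an $m\times n$ grid of squares in which each square is colored black or white. An $m\times n$ diagram is a Cauchon diagram if whenever a square is colored black, either every square in the same row to its left is also black or every square in the same column above it is also black. For $S\subseteq\{1,\dots,m\}$, $C(S)$ denotes the $m\times 1$ diagram (column) whose white squares are precisely in the rows indexed by $S$, and $\Sigma_m=\{C(S) : S\subseteq\{1,\dots,m\}\}$. The set of all diagrams with exactly $m$ rows (and any number $n\ge 0$ of columns), under horizontal concatenation (placing the second diagram immediately to the right of the first), with the empty diagram as identity, is identified with the free monoid $\Sigma_m^*$ of finite words on the finite alphabet $\Sigma_m$. $\mathcal{C}_m\subseteq\Sigma_m^*$ is the set of Cauchon diagrams with exactly $m$ rows. A subset of $\Sigma^*$ ($\Sigma$ a finite alphabet) is regular if it is the set of words accepted by some (deterministic) finite state automaton $(Q,\Sigma,\delta,q_0,F)$ with finite state set $Q$, transition function $\delta:Q\times\Sigma\to Q$, initial state $q_0$, and set of accepting states $F\subseteq Q$; a word $w$ is accepted if $\delta(q_0,w)\in F$, where $\delta$ is extended to words by $\delta(q,\varepsilon)=q$ for the empty word $\varepsilon$ and $\delta(q,wx)=\delta(\delta(q,w),x)$. *)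

(* Defs.v *)
From mathcomp Require Import all_boot all_algebra.

Set Implicit Arguments.
Unset Strict Implicit.
Unset Printing Implicit Defensive.

(* Row 0 is the top row and column 0 the leftmost column; an entry is [true]
   when the square is white. *)
Definition diagram (m n : nat) : Type := 'M[bool]_(m, n).

Definition white (m n : nat) (D : diagram m n) (i : 'I_m) (j : 'I_n) : bool :=
  D i j.

Definition black (m n : nat) (D : diagram m n) (i : 'I_m) (j : 'I_n) : bool :=
  ~~ D i j.

Definition Cauchon (m n : nat) (D : diagram m n) : Prop :=
  forall (i : 'I_m) (j : 'I_n), black D i j ->
    (forall j' : 'I_n, j' < j -> black D i j') \/
    (forall i' : 'I_m, i' < i -> black D i' j).

Definition Csub (m : nat) (S : {set 'I_m}) : diagram m 1 :=
  (\col_(i < m) (i \in S))%R.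

(* The letters are all m x 1 diagrams, i.e. exactly the columns [Csub S]:
   see [Csub_bij]. *)
Definition Sigma (m : nat) : finType := 'cV[bool]_m.

Lemma white_Csub (m : nat) (S : {set 'I_m}) (i : 'I_m) :
  white (Csub S) i ord0 = (i \in S).
Proof. by rewrite /white mxE. Qed.

Lemma Csub_bij (m : nat) : bijective (@Csub m : {set 'I_m} -> Sigma m).
Proof.
exists (fun c : Sigma m => [set i | white (c : diagram m 1) i ord0]).
  by move=> S; apply/setP=> i; rewrite inE white_Csub.
by move=> c; apply/matrixP=> i j; rewrite mxE inE /white (ord1 j).
Qed.

Fixpoint diagram_of_word (m : nat) (w : seq (Sigma m)) : diagram m (size w) :=
  match w return diagram m (size w) with
  | [::] => const_mx true
  | c :: w' => row_mx (c : diagram m 1) (diagram_of_word w')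
  end.

Lemma diagram_of_wordE (m : nat) (w : seq (Sigma m)) (i : 'I_m)
    (j : 'I_(size w)) :
  diagram_of_word w i j = (tnth (in_tuple w) j : diagram m 1) i ord0.
Proof.
rewrite (tnth_nth (const_mx true)) /=.
elim: w j => [|c w IH] j; first by case: j.
have -> : j = @unsplit 1 (size w) (@split 1 _ j) by rewrite splitK.
case: (@split 1 _ j) => k; first by rewrite [LHS]row_mxEl (ord1 k).
by rewrite [LHS]row_mxEr IH.
Qed.

Lemma diagram_of_word_inj (m : nat) (w1 w2 : seq (Sigma m))
    (e : size w1 = size w2) :
  castmx (erefl m, e) (diagram_of_word w1) = diagram_of_word w2 -> w1 = w2.
Proof.
move=> E; apply: (@eq_from_nth _ (const_mx true)) => // k lt_k1.
have lt_k2 : k < size w2 by rewrite -e.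
apply/matrixP=> i j; rewrite ord1.
have := congr1 (fun D : diagram m (size w2) => D i (Ordinal lt_k2)) E.
rewrite castmxE !diagram_of_wordE !(tnth_nth (const_mx true)) /= cast_ord_id.
by [].
Qed.

Lemma diagram_of_word_surj (m n : nat) (D : diagram m n) :
  exists (w : seq (Sigma m)) (e : size w = n),
    castmx (erefl m, e) (diagram_of_word w) = D.
Proof.
elim: n D => [|n IH] D.
  by exists [::], erefl; apply/matrixP=> i [].
have [w [e wD]] := IH (rsubmx (D : 'M_(m, 1 + n))).
exists (lsubmx (D : 'M_(m, 1 + n)) :: w), (congr1 succn e).
by case: n / e D wD {IH} => D wD; rewrite castmx_id /= -[RHS](@hsubmxK _ m 1 (size w)) -wD castmx_id.
Qed.

Lemma diagram_of_word_cat (m : nat) (w1 w2 : seq (Sigma m)) :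
  diagram_of_word (w1 ++ w2) =
  castmx (erefl m, esym (size_cat w1 w2))
    (row_mx (diagram_of_word w1) (diagram_of_word w2)).
Proof.
apply/matrixP=> i j; rewrite castmxE cast_ord_id /= esymK.
rewrite diagram_of_wordE (tnth_nth (const_mx true)) /= nth_cat mxE.
case: splitP => k /= ->; rewrite diagram_of_wordE (tnth_nth (const_mx true)) //=.
  by rewrite ltn_ord.
by rewrite ltnNge leq_addr addKn.
Qed.

(* Diagrams with m rows are identified with words over [Sigma m]; see
   [diagram_of_word_inj], [diagram_of_word_surj] and [diagram_of_word_cat]. *)
Definition Cauchon_language (m : nat) (w : seq (Sigma m)) : Prop :=
  Cauchon (diagram_of_word w).

Record dfa (A : finType) : Type := DFA {
  dfa_state : finType;
  dfa_trans : dfa_state -> A -> dfa_state;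
  dfa_init : dfa_state;
  dfa_final : {set dfa_state}
}.

Definition dfa_run (A : finType) (M : dfa A) (q : dfa_state M) (w : seq A) :
  dfa_state M := foldl (@dfa_trans A M) q w.

Lemma dfa_run_nil (A : finType) (M : dfa A) (q : dfa_state M) :
  dfa_run q [::] = q.
Proof. by []. Qed.

Lemma dfa_run_rcons (A : finType) (M : dfa A) (q : dfa_state M) (w : seq A)
    (x : A) :
  dfa_run q (rcons w x) = dfa_trans (dfa_run q w) x.
Proof. by rewrite /dfa_run foldl_rcons. Qed.

Definition dfa_accepts (A : finType) (M : dfa A) (w : seq A) : bool :=
  dfa_run (dfa_init M) w \in dfa_final M.

Definition regular (A : finType) (L : seq A -> Prop) : Prop :=
  exists M : dfa A, forall w : seq A, L w <-> dfa_accepts M w.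

(* Main.v *)
Require Import Defs.
From mathcomp Require Import all_boot all_algebra.

Set Implicit Arguments.
Unset Strict Implicit.
Unset Printing Implicit Defensive.

(* Reading a diagram from left to right, the only information about the columns
   already read that the Cauchon condition needs is the set of rows containing
   a white square: a new column is admissible when each of its black squares
   lying in such a row has only black squares above it.  The automaton stores
   this set, and moves to a sink after an inadmissible column. *)

Section CauchonAutomaton.
Variable m : nat.
Implicit Types (W : {set 'I_m}) (c : Sigma m) (w : seq (Sigma m)).

Definition admissible W c : bool :=
  [forall i, (i \in W) && ~~ c i ord0 ==>
    [forall i' : 'I_m, (i' < i) ==> ~~ c i' ord0]].

Definition add_white_rows W c : {set 'I_m} := W :|: [set i | c i ord0].

Definition Cauchon_trans (q : option {set 'I_m}) c : option {set 'I_m} :=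
  if q is Some W then
    if admissible W c then Some (add_white_rows W c) else None
  else None.

Definition Cauchon_dfa : dfa (Sigma m) :=
  DFA Cauchon_trans (Some set0) [set~ None].

(* The Cauchon condition for [w] placed to the right of a diagram whose rows
   containing a white square are those in [W]. *)
Definition Cauchon_after W w : Prop :=
  forall (i : 'I_m) k, k < size w -> ~~ nth (const_mx true) w k i ord0 ->
    (i \notin W /\
     forall k', k' < k -> ~~ nth (const_mx true) w k' i ord0) \/
    (forall i' : 'I_m, i' < i -> ~~ nth (const_mx true) w k i' ord0).

Lemma admissibleP W c :
  reflect (forall i, ~~ c i ord0 ->
             i \notin W \/ forall i' : 'I_m, i' < i -> ~~ c i' ord0)
          (admissible W c).
Proof.
apply: (iffP forallP) => [adm i ci | adm i].
  have := adm i; rewrite ci andbT; case: (i \in W) => /=; last by left.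
  by move/forallP=> above; right=> i' lt_i'i; have := above i'; rewrite lt_i'i.
apply/implyP=> /andP[iS ci]; apply/forallP=> i'; apply/implyP=> lt_i'i.
by case: (adm i ci) => [|above]; [rewrite iS | apply: above].
Qed.

(** The squares of [c] have only the earlier diagram to their left, so [W] alone decides about them.
    To the left of a square of [w] lie the earlier diagram, [c] and a prefix of [w];
    [add_white_rows W c] records the first two together. *)
Lemma Cauchon_after_cons W c w :
  Cauchon_after W (c :: w) <->
  admissible W c /\ Cauchon_after (add_white_rows W c) w.
Proof.
split=> [Cw | [/admissibleP adm Cw] i [|k] lt_kw ci].
- split=> [|i k lt_kw ci].
    apply/admissibleP=> i ci.
    by case: (Cw i 0 isT ci) => [[iS _]|above]; [left | right].
  case: (Cw i k.+1 lt_kw ci) => [[iS left_black]|above]; [left | by right].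
  split=> [|k' lt_k'k]; last exact: (left_black k'.+1).
  by rewrite !inE negb_or iS (left_black 0).
- by case: (adm i ci) => [iS|above]; [left | right].
- case: (Cw i k lt_kw ci) => [[]|above]; last by right.
  rewrite !inE negb_or => /andP[iS ci0] left_black; left; split=> //.
  by case=> [|k'] //; apply: left_black.
Qed.

Lemma Cauchon_trans_sink w : foldl Cauchon_trans None w = None.
Proof. by elim: w. Qed.

Lemma Cauchon_after_run W w :
  Cauchon_after W w <-> foldl Cauchon_trans (Some W) w != None.
Proof.
(* [W] must vary, since the tail is read from [add_white_rows W c]. *)
elim: w W => [|c w IHw] W; first by split.
apply: iff_trans (Cauchon_after_cons W c w) _ => /=; case: (admissible W c).
  by split=> [[_ /IHw]|/IHw].
by rewrite Cauchon_trans_sink; split=> [[]|].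
Qed.

Lemma Cauchon_languageE w : Cauchon_language w <-> Cauchon_after set0 w.
Proof.
(* Column indices stay below [size w], so the white default column of [nth] is never read. *)
have entry i (j : 'I_(size w)) :
    black (diagram_of_word w) i j = ~~ nth (const_mx true) w j i ord0.
  by rewrite /black diagram_of_wordE (tnth_nth (const_mx true)).
split=> [Cw i k lt_kw ci | Cw i j]; last first.
  rewrite entry => ci; case: (Cw i j (ltn_ord j) ci) => [[_ left_black]|above].
    by left=> j' lt_j'j; rewrite entry; apply: left_black.
  by right=> i' lt_i'i; rewrite entry; apply: above.
have := Cw i (Ordinal lt_kw); rewrite entry => /(_ ci) [left_black|above].
  left; split=> [|k' lt_k'k]; first by rewrite inE.
  by have := left_black (Ordinal (ltn_trans lt_k'k lt_kw)) lt_k'k; rewrite entry.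
by right=> i' /above; rewrite entry.
Qed.

End CauchonAutomaton.

Theorem theorem6p1 (m : nat) : regular (@Cauchon_language m).
Proof.
exists (Cauchon_dfa m) => w.
rewrite /dfa_accepts !inE.
exact: iff_trans (Cauchon_languageE w) (Cauchon_after_run set0 w).
Qed.
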